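(* Let $(e_n)$ be a basis of a Banach space $X$. Then the following assertions are equivalent: (a) $(e_n)$ is partially greedy. (b) $(e_n)$ is quasi-greedy and conservative. (c) There exists a constant $C$ such that for all $x\in X$ and $m\in\mathbb{N}$, $$\|x-G_m(x)\|\le C\,\tilde\sigma_m^L(x),\qquad\text{where } \tilde\sigma_m^L(x)=\inf\{\|x-P_A(x)\| : |A|\le m,\ A<\alpha_m(x)\}.$$
   Context: Standing setting: $X$ is a real Banach space, possibly finite-dimensional, and $(e_n)$ is a seminormalized Schauder basis of $X$ (i.e. $0<\inf_n\|e_n\|\le\sup_n\|e_n\|<\infty$), with biorthogonal functionals $(e_n^* )$. If $\dim X=N<\infty$, $(e_n)_{n=1}^N$ is an algebraic basis, all indices and index sets lie in $\{1,\dots,N\}$ instead of $\mathbb{N}$, and $m\le N$. $\mathrm{supp}(x)=\{n: e_n^*(x)\ne0\}$; for an index set $A$, $P_A(x)=\sum_{i\in A}e_i^*(x)e_i$, $1_A=\sum_{i\in A}e_i$, $|A|$ is its cardinality; $A<B$ means $\max A<\min B$, and for an integer $a$, $A<a$ means every element of $A$ is $<a$ (vacuous if $A=\emptyset$). Greedy approximation: a greedy ordering for $x\in X$ is an injective map $\rho$ from the index set into itself with $\mathrm{supp}(x)$ contained in the range of $\rho$ and $|e_{\rho(j)}^*(x)|\ge|e_{\rho(k)}^*(x)|$ whenever $j<k$. Put $\Lambda_m(x)=\{\rho(1),\dots,\rho(m)\}$, $G_m(x)=\sum_{n\in\Lambda_m(x)}e_n^*(x)e_n$, $\alpha_m(x)=\min\Lambda_m(x)$.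 Statements involving $G_m(x)$, $\Lambda_m(x)$, $\alpha_m(x)$ are meant for any greedy ordering of $x$ (the same ordering throughout the statement). Definitions: $(e_n)$ is partially greedy if there is $C$ with $\|x-G_m(x)\|\le C\|\sum_{n>m}e_n^*(x)e_n\|$ for all $x\in X$, $m\in\mathbb{N}$. It is quasi-greedy if there is $C$ with $\|G_m(x)\|\le C\|x\|$ for all $x\in X$, $m\in\mathbb{N}$. It is conservative if there is $\Gamma_c$ with $\|1_A\|\le\Gamma_c\|1_B\|$ for all finite index sets $A,B$ with $A<B$ and $|A|\le|B|$. *)

(* Defs.v *)
From mathcomp Require Import all_boot all_order all_algebra finmap.
From mathcomp Require Import all_classical all_reals all_analysis.
Import Order.TTheory GRing.Theory Num.Theory.
Import numFieldNormedType.Exports.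

Set Implicit Arguments.
Unset Strict Implicit.
Unset Printing Implicit Defensive.

Local Open Scope classical_set_scope.
Local Open Scope ring_scope.

(* The index set: {1, 2, ...} for N = None, {1, ..., k} for N = Some k.
   Families are indexed by all of nat; their values outside the index set,
   in particular at 0, are irrelevant. *)
Definition index_set (N : option nat) : set nat :=
  [set n | (1 <= n)%N /\ if N is Some k then (n <= k)%N else True].

Section Basis.
Context {R : realType} {X : completeNormedModType R}.
Variables (N : option nat) (e : nat -> X).

(* The coefficients are required to vanish outside the index set, so that
   uniqueness of an expansion is Leibniz equality (up to funext) of families
   nat -> R. *)
Definition expansion (x : X) (a : nat -> R) : Prop :=
  (forall n, ~ index_set N n -> a n = 0) /\
  match N with
  | None => (fun k => \sum_(1 <= n < k.+1) a n *: e n) @ \oo --> x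
  | Some k => x = \sum_(1 <= n < k.+1) a n *: e n
  end.

(* Schauder basis of X if N = None, algebraic basis of the k-dimensional
   space X if N = Some k. *)
Definition schauder_basis : Prop :=
  forall x : X, exists! a : nat -> R, expansion x a.

Definition seminormalized : Prop :=
  exists c C : R, 0 < c /\ forall n, index_set N n -> c <= `|e n| <= C.

(* e_n^*(x); meaningful when schauder_basis holds. *)
Definition coord (n : nat) (x : X) : R := get [set a | expansion x a] n.

Definition supp (x : X) : set nat := [set n | index_set N n /\ coord n x != 0].

Definition index_subset (A : {fset nat}) : Prop :=
  forall n, n \in A -> index_set N n.

Definition proj (A : {fset nat}) (x : X) : X := \sum_(i <- A) coord i x *: e i.

Definition indic_sum (A : {fset nat}) : X := \sum_(i <- A) e i.

(* If N = Some k the coordinates of index > k are 0, so the series is then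
   the finite sum over m < n <= k. *)
Definition tail (m : nat) (x : X) : X :=
  \big[+%R/0]_(m.+1 <= n <oo) (coord n x *: e n).

Definition greedy_ordering (x : X) (rho : nat -> nat) : Prop :=
  [/\ forall j, index_set N j -> index_set N (rho j),
      forall j k, index_set N j -> index_set N k -> rho j = rho k -> j = k,
      supp x `<=` rho @` index_set N &
      forall j k, index_set N j -> index_set N k -> (j < k)%N ->
        `|coord (rho k) x| <= `|coord (rho j) x| ].

Definition Lambda (rho : nat -> nat) (m : nat) : {fset nat} :=
  [fset rho j | j in iota 1 m]%fset.

Definition greedy_sum (rho : nat -> nat) (m : nat) (x : X) : X :=
  proj (Lambda rho m) x.

(* min (Lambda rho m) for 1 <= m *)
Definition alpha (rho : nat -> nat) (m : nat) : nat :=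
  \big[minn/rho 1%N]_(i <- Lambda rho m) i.

(* In the next definitions "index_set N m" expresses 1 <= m, and m <= k when
   N = Some k. *)
Definition partially_greedy : Prop :=
  exists C : R, forall (x : X) (rho : nat -> nat) (m : nat),
    greedy_ordering x rho -> index_set N m ->
    `|x - greedy_sum rho m x| <= C * `|tail m x|.

Definition quasi_greedy : Prop :=
  exists C : R, forall (x : X) (rho : nat -> nat) (m : nat),
    greedy_ordering x rho -> index_set N m ->
    `|greedy_sum rho m x| <= C * `|x|.

Definition conservative : Prop :=
  exists C : R, forall A B : {fset nat},
    index_subset A -> index_subset B ->
    (forall a b, a \in A -> b \in B -> (a < b)%N) ->
    (#|` A| <= #|` B|)%N ->
    `|indic_sum A| <= C * `|indic_sum B|.

Definition sigmaL (rho : nat -> nat) (m : nat) (x : X) : R :=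
  inf [set `|x - proj A x| | A in
        [set A : {fset nat} | [/\ index_subset A, (#|` A| <= m)%N &
           forall a, a \in A -> (a < alpha rho m)%N]]].

End Basis.

(* Main.v *)
(* For a finitely supported vector every greedy set (a set of indices carrying
   the largest coefficients) is Lambda_m of some greedy ordering, so a bound on
   the G_m is a bound on the projections onto greedy sets, first for finitely
   supported vectors and then, by truncation, for all vectors.

   If (e_n) is quasi-greedy and conservative, L = Lambda_m(x), |A| <= |L| and
   A \ L < L \ A, put y = x - P_A(x). Then
     x - P_L(x) = y - P_{L\A}(y) + P_{A\L}(x),
   where L\A is a greedy set of y. With r the largest coefficient of x on A\L,
   |P_{A\L}(x)| is at most a multiple of r |1_{L\A}| by convexity and
   conservativity, and r |1_{L\A}| is at most a multiple of |P_{L\A}(y)| by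
   Abel summation. Taking A = {1, ..., m} gives (a), and A < alpha_m(x) gives
   (c).

   Conversely, A = {} in (c) gives quasi-greediness; 1_A + 1_B with greedy set B
   gives conservativity. From (a), quasi-greediness follows from the finiteness
   of the basis constant; conservativity from the vector 1_{E u B} with
   E = {1, ..., max A} and greedy set (E \ A) u B. *)
Require Import Defs.
From mathcomp Require Import all_boot all_order all_algebra finmap.
From mathcomp Require Import all_classical all_reals all_analysis.
From mathcomp Require Import ring lra.
Import Order.TTheory GRing.Theory Num.Theory.
Import numFieldNormedType.Exports.
Local Open Scope classical_set_scope.
Local Open Scope ring_scope.

Set Implicit Arguments.
Unset Strict Implicit.
Unset Printing Implicit Defensive.

(** * Coordinate functionals and convergence of the expansions *)

Section Coordinates.
Context {R : realType} {X : completeNormedModType R}.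
Variables (N : option nat) (e : nat -> X).

Local Notation I := (index_set N).
Local Notation expansion := (Defs.expansion N e).
Local Notation coord := (Defs.coord N e).
Local Notation proj := (Defs.proj N e).

Definition partial_sum (a : nat -> R) (n : nat) : X :=
  \sum_(1 <= i < n.+1) a i *: e i.

Lemma partial_sumS a n :
  partial_sum a n.+1 = partial_sum a n + a n.+1 *: e n.+1.
Proof. by rewrite /partial_sum big_nat_recr. Qed.

Lemma partial_sumD a b n :
  partial_sum (fun i => a i + b i) n = partial_sum a n + partial_sum b n.
Proof. by rewrite -big_split; apply: eq_bigr => i _; rewrite scalerDl. Qed.

Lemma partial_sumZ k a n :
  partial_sum (fun i => k * a i) n = k *: partial_sum a n.
Proof. by rewrite scaler_sumr; apply: eq_bigr => i _; rewrite scalerA. Qed.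

Lemma index_set_le m n : I n -> (0 < m)%N -> (m <= n)%N -> I m.
Proof.
by move=> [n0 nN] m0 mn; split=> //; case: (N) nN => // k; exact: leq_trans.
Qed.

Lemma partial_sum_stable k a m n : (k <= m)%N -> (m <= n)%N ->
  (forall i, (k < i)%N -> a i = 0) -> partial_sum a n = partial_sum a m.
Proof.
move=> km mn a0; rewrite /partial_sum (@big_cat_nat _ _ _ m.+1) //=.
rewrite [X in _ + X]big1_seq ?addr0// => i; rewrite mem_index_iota.
by move=> /andP[_ /andP[mi _]]; rewrite a0 ?scale0r// (leq_ltn_trans km).
Qed.

Lemma partial_sum_cvg k a : (forall i, (k < i)%N -> a i = 0) ->
  partial_sum a n @[n --> \oo] --> partial_sum a k.
Proof.
move=> a0; apply: cvg_near_cst; near=> n.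
by apply: (@partial_sum_stable k) => //; near: n; exact: nbhs_infty_ge.
Unshelve. all: by end_near. Qed.

(** When [N = Some k] the coefficients vanish beyond [k], so the partial sums are eventually
    constant. Convergence thus describes both cases, and later proofs need no case split on [N]. *)
Lemma expansionP x a : expansion x a <->
  (forall n, ~ I n -> a n = 0) /\ partial_sum a n @[n --> \oo] --> x.
Proof.
rewrite /expansion /Defs.expansion; case N_k: N => [k|]; last by [].
have a_cvg : (forall n, ~ I n -> a n = 0) ->
    partial_sum a n @[n --> \oo] --> partial_sum a k.
  by move=> a0; apply: partial_sum_cvg => i ki; apply: a0; rewrite N_k => -[_];
    rewrite leqNgt ki.
rewrite -N_k; split=> -[a0]; first by move=> ->; split=> //; exact: a_cvg.
by move=> ax; split=> //; apply: (cvg_unique _ ax (a_cvg a0)).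
Qed.

Hypothesis basis_e : schauder_basis N e.

Lemma coord_expansion x : expansion x (coord ^~ x).
Proof.
have [a [xa _]] := basis_e x.
exact: (@getPex _ [set a | expansion x a] (ex_intro _ a xa)).
Qed.

Lemma coord_unique x a : expansion x a -> coord ^~ x = a.
Proof.
have [b [xb b_uniq]] := basis_e x => /b_uniq <-; apply/esym/b_uniq.
exact: coord_expansion.
Qed.

Lemma coord_notin n x : ~ I n -> coord n x = 0.
Proof. by have [+ _] := coord_expansion x => /[apply]. Qed.

Lemma partial_sum_coord_cvg x : partial_sum (coord ^~ x) n @[n --> \oo] --> x.
Proof. by have /expansionP[] := coord_expansion x. Qed.
Arguments partial_sum_coord_cvg : clear implicits.

(** The termwise sum of two expansions is an expansion of [x + y]; uniqueness does the rest. *)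
Lemma coordD n x y : coord n (x + y) = coord n x + coord n y.
Proof.
suff /coord_unique/(congr1 (@^~ n)) :
    expansion (x + y) (fun i => coord i x + coord i y) by [].
apply/expansionP; split=> [i Ii|]; first by rewrite !coord_notin// addr0.
under eq_fun do rewrite partial_sumD.
by apply: cvgD; exact: partial_sum_coord_cvg.
Qed.

Lemma coordZ n k x : coord n (k *: x) = k * coord n x.
Proof.
suff /coord_unique/(congr1 (@^~ n)) :
    expansion (k *: x) (fun i => k * coord i x) by [].
apply/expansionP; split=> [i Ii|]; first by rewrite coord_notin// mulr0.
under eq_fun do rewrite partial_sumZ.
by apply: cvgZr; exact: partial_sum_coord_cvg.
Qed.

Lemma coordN n x : coord n (- x) = - coord n x.
Proof. by rewrite -scaleN1r coordZ mulN1r. Qed.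

Lemma coordB n x y : coord n (x - y) = coord n x - coord n y.
Proof. by rewrite coordD coordN. Qed.

Lemma coord0 n : coord n 0 = 0.
Proof. by rewrite -(scale0r 0) coordZ mul0r. Qed.

Lemma coord_sum n (J : Type) (s : seq J) (x : J -> X) :
  coord n (\sum_(j <- s) x j) = \sum_(j <- s) coord n (x j).
Proof. by apply: (big_morph (coord n)) => [y z|]; rewrite ?coordD ?coord0. Qed.

Lemma coord_basis_vec n i : I i -> coord n (e i) = (n == i)%:R.
Proof.
move=> Ii; suff /coord_unique/(congr1 (@^~ n)) :
    expansion (e i) (fun j => (j == i)%:R) by [].
apply/expansionP; split=> [j Ij|]; first by case: eqP => // ji; rewrite ji in Ij.
suff /esym E : partial_sum (fun j => (j == i)%:R) i = e i.
  rewrite [X in _ --> X]E; apply: partial_sum_cvg => j.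
  by rewrite ltn_neqAle eq_sym => /andP[/negbTE->].
have [i0 _] := Ii; rewrite -(prednK i0) partial_sumS prednK// eqxx scale1r.
rewrite /partial_sum big1_seq ?add0r// => j; rewrite mem_index_iota prednK//.
move=> /andP[_ /andP[_ ji]].
by rewrite ltn_eqF// scale0r.
Qed.

Lemma coord_fsum (A : {fset nat}) (b : nat -> R) n : index_subset N A ->
  coord n (\sum_(i <- A) b i *: e i) = if n \in A then b n else 0.
Proof.
move=> AI; rewrite coord_sum.
rewrite (eq_big_seq (fun i => if i == n then b n else 0)); last first.
  by move=> i Ai; rewrite coordZ coord_basis_vec; [case: eqVneq => [->|]|exact: AI];
    rewrite ?mulr1 ?mulr0.
rewrite -big_mkcond /=; case: ifPn => nA.
  rewrite -big_filter (perm_big [:: n]) ?big_seq1//.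
  rewrite uniq_perm ?filter_uniq ?fset_uniq// => i; rewrite mem_filter inE.
  by case: eqP => // ->.
rewrite big1_seq// => i /andP[/eqP -> Ai]; by rewrite Ai in nA.
Qed.

Lemma coord_proj (A : {fset nat}) n x : index_subset N A ->
  coord n (proj A x) = if n \in A then coord n x else 0.
Proof. exact: coord_fsum. Qed.

Lemma coord_indic_sum (A : {fset nat}) n : index_subset N A ->
  coord n (indic_sum e A) = (n \in A)%:R.
Proof.
move=> AI; rewrite /indic_sum; under eq_bigr do rewrite -[e _]scale1r.
by rewrite coord_fsum//; case: ifP.
Qed.

Lemma eq_coord_proj (A : {fset nat}) x y :
  {in A, coord ^~ x =1 coord ^~ y} -> proj A x = proj A y.
Proof. by move=> xy; apply: eq_big_seq => i /xy /= ->. Qed.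

(** Both vectors are the limit of the same partial sums. This lets vector identities be checked one
    coordinate at a time. *)
Lemma coord_inj x y : coord ^~ x =1 coord ^~ y -> x = y.
Proof.
move=> /funext xy; have := partial_sum_coord_cvg x; rewrite xy => yx.
exact: (cvg_unique _ yx (partial_sum_coord_cvg y)).
Qed.

(** Cutting down to the index set keeps this a legal index set when [N = Some k] and [n] exceeds
    [k], as happens in limits over [n]. *)
Definition initial_index (n : nat) : {fset nat} :=
  [fset i in iota 1 n | `[< I i >]]%fset.

Lemma mem_initial_index n i :
  (i \in initial_index n) = [&& (0 < i)%N, (i <= n)%N & `[< I i >]].
Proof. by rewrite !inE mem_iota add1n ltnS -andbA. Qed.

Lemma initial_index_subset n : index_subset N (initial_index n).
Proof. by move=> i; rewrite mem_initial_index => /and3P[_ _ /asboolP]. Qed.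

Lemma partial_sum_coord n x :
  partial_sum (coord ^~ x) n = proj (initial_index n) x.
Proof.
rewrite /partial_sum /proj /Defs.proj /index_iota subSS subn0.
rewrite (bigID (fun i => `[< I i >])) /= [X in _ + X]big1 ?addr0; last first.
  by move=> i /asboolPn /coord_notin ->; rewrite scale0r.
rewrite -big_filter; apply: perm_big.
rewrite uniq_perm ?filter_uniq ?iota_uniq ?fset_uniq//.
by move=> i; rewrite mem_filter mem_initial_index mem_iota add1n ltnS andbC andbA.
Qed.

Lemma proj_initial_cvg x : proj (initial_index n) x @[n --> \oo] --> x.
Proof.
by under eq_fun do rewrite -partial_sum_coord; exact: partial_sum_coord_cvg.
Qed.

Lemma tailE m x : tail N e m x = x - proj (initial_index m) x.
Proof.
apply: (@cvg_lim _ (@norm_hausdorff _ _)).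
(* After the shift the upper bound never falls below [m.+1], so each sum is a full partial sum minus
   the first [m] terms. *)
rewrite -(cvg_shiftn m.+1) /=.
have -> : (fun n => \sum_(m.+1 <= i < n + m.+1) coord i x *: e i) =
    (fun n => partial_sum (coord ^~ x) (n + m) - proj (initial_index m) x).
  apply/funext => n; rewrite -partial_sum_coord /partial_sum.
  rewrite (@big_cat_nat _ _ _ m.+1 1 (n + m).+1)//= ?ltnS ?leq_addl//.
  by rewrite addrAC subrr add0r addnS.
apply: cvgB; last exact: cvg_cst.
by rewrite (@cvg_shiftn m _ (partial_sum (coord ^~ x))); exact: partial_sum_coord_cvg.
Qed.

End Coordinates.

(** * Finiteness of the basis constant *)

Section BasisConstant.
Context {R : realType} {X : completeNormedModType R}.
Variables (N : option nat) (e : nat -> X).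

Local Notation I := (index_set N).
Local Notation coord := (Defs.coord N e).
Local Notation proj := (Defs.proj N e).
Local Notation psum n x := (partial_sum e (coord ^~ x) n).

Hypothesis basis_e : schauder_basis N e.

Lemma basis_neq0 i : I i -> e i != 0.
Proof.
move=> Ii; apply/eqP => ei0; have := coord_basis_vec basis_e i Ii.
by rewrite ei0 coord0// eqxx => /eqP; rewrite eq_sym oner_eq0.
Qed.

Lemma psumD n x y : psum n (x + y) = psum n x + psum n y.
Proof. by rewrite -partial_sumD; apply: eq_bigr => i _; rewrite coordD. Qed.

Lemma psumZ n k x : psum n (k *: x) = k *: psum n x.
Proof. by rewrite -partial_sumZ; apply: eq_bigr => i _; rewrite coordZ. Qed.

Lemma psumN n x : psum n (- x) = - psum n x.
Proof. by rewrite -scaleN1r psumZ scaleN1r. Qed.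

Lemma psumB n x y : psum n (x - y) = psum n x - psum n y.
Proof. by rewrite psumD psumN. Qed.

Lemma psum0 n : psum n 0 = 0.
Proof. by rewrite -(scale0r 0) psumZ !scale0r. Qed.

(** A natural bound is chosen so that the sets of vectors sharing a bound form a countable cover of
    [X], as Baire requires. *)
Lemma psum_bounded x : exists m : nat, forall n, `|psum n x| <= m%:R.
Proof.
have : cvgn (partial_sum e (coord ^~ x)).
  by apply/cvg_ex; exists x; exact: partial_sum_coord_cvg.
move=> /cvg_seq_bounded[M [_ /(_ (M + 1))]]; rewrite ltrDl ltr01 => /(_ isT) le_M.
exists (Num.truncn (M + 1)).+1 => n; apply: le_trans (le_M n Logic.I) _.
exact/ltW/truncnS_gt.
Qed.

Lemma partial_sum_pointwise_cvg (a_ : nat -> nat -> R) a n :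
  (forall i, a_ m i @[m --> \oo] --> a i) ->
  partial_sum e (a_ m) n @[m --> \oo] --> partial_sum e a n.
Proof.
move=> a_cvg; elim: n => [|n IHn].
  rewrite /partial_sum big_geq//; under eq_fun do rewrite big_geq//.
  exact: cvg_cst.
rewrite partial_sumS; under eq_fun do rewrite partial_sumS.
by apply: cvgD => //; exact: cvgZl.
Qed.

(* By Baire, the vectors whose partial sums are bounded by some [m] are dense
   in some ball; differences of such vectors are then dense around [0]. *)
Lemma halving_approximation : exists2 K : R, 0 < K & forall y : X, exists u : X,
  `|y - u| <= `|y| / 2 /\ forall n, `|psum n u| <= K * `|y|.
Proof.
pose E (m : nat) : set X := [set x | forall n, `|psum n x| <= m%:R].
have [m [x0 [r r0 ball_E]]] : exists m x0, exists2 r : R, 0 < r &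
    ball x0 r `<=` closure (E m).
  have [m] : exists m, ~ dense (~` closure (E m)).
    apply: contrapT => /forallNP dense_E.
    have : dense (\bigcap_m (~` closure (E m))).
      apply: Baire => m; split; last by apply: contrapT; exact: dense_E.
      exact/closed_openC/closed_closure.
    move=> /(_ setT) []; [by exists 0|exact: openT|move=> x [_ xE]].
    have [m xm] := psum_bounded x.
    by apply: (xE m) => //; exact: subset_closure.
  move=> /denseNE[U [[x0 [U_open Ux0]] U_E]].
  have /nbhs_ballP[r /= r0 rU] := open_nbhs_nbhs (conj U_open Ux0).
  exists m, x0, r => // y /rU Uy; apply: contrapT => yE.
  by have : (U `&` ~` closure (E m)) y by []; rewrite U_E.
have approx y eps : 0 < eps -> `|y| < r ->
    exists2 u, `|y - u| < eps & forall n, `|psum n u| <= (2 * m)%:R.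
  move=> eps0 yr.
  have near_E z : ball x0 r z -> exists2 u, E m u & `|z - u| < eps / 2.
    move=> /ball_E /(_ (ball z (eps / 2))) [].
      by apply: nbhsx_ballx; rewrite divr_gt0.
    by move=> u [Eu]; rewrite -ball_normE /= => zu; exists u.
  have [|u Eu xyu] := near_E (x0 + y).
    by rewrite -ball_normE /= opprD addrA subrr sub0r normrN.
  have [|v Ev xv] := near_E x0; first exact: ballxx.
  exists (u - v) => [|n]; last first.
    rewrite psumB natrM mulr_natl mulr2n.
    by apply: le_trans (ler_normB _ _) _; exact: lerD.
  have -> : y - (u - v) = (x0 + y - u) - (x0 - v).
    rewrite !opprB -[x0 + y - u]addrA [in RHS](addrC v) addrACA subrr add0r.
    by rewrite (addrC v) addrA.
  by rewrite (le_lt_trans (ler_normB _ _))// [ltRHS]splitr ltrD.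
(* Scaling by [k] brings [y] to norm [r / 2]. Scaling back turns an error of [r / 4] into half the
   norm of [y], and the bound [2 * m] into [K] times that norm. The added 1 keeps the constant
   positive when [m = 0]. *)
pose K := (2 * m)%:R * (2 / r).
exists (K + 1) => [|y]; first by rewrite ltr_wpDl// !mulr_ge0// invr_ge0 ltW.
have [->|y0] := eqVneq y 0.
  by exists 0; rewrite subr0 !normr0 mul0r mulr0; split=> // n; rewrite psum0 normr0.
have ny0 : 0 < `|y| by rewrite normr_gt0.
pose k := r / (2 * `|y|); have k0 : 0 < k by rewrite divr_gt0// mulr_gt0.
have nky : `|k *: y| = r / 2.
  by rewrite normrZ gtr0_norm// /k invfM mulrA divfK ?gt_eqF.
have [|//|u yu u_le] := @approx (k *: y) (r / 4).
  by rewrite divr_gt0.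
  by rewrite nky ltr_pdivrMr// ltr_pMr// ltr1n.
exists (k^-1 *: u); split => [|n].
  rewrite -[y in y - _](scalerK (lt0r_neq0 k0)) -scalerBr normrZ.
  rewrite gtr0_norm ?invr_gt0// ler_pdivrMl//; apply: (le_trans (ltW yu)).
  suff -> : r / 4 = k * (`|y| / 2) by [].
  by rewrite /k; field; exact: lt0r_neq0.
rewrite psumZ normrZ gtr0_norm ?invr_gt0// ler_pdivrMl//.
apply: le_trans (u_le n) _.
suff -> : k * ((K + 1) * `|y|) = (2 * m)%:R + r / 2.
  by rewrite lerDl divr_ge0// ltW.
by rewrite /k /K; field; rewrite !lt0r_neq0.
Qed.

(** As in the open mapping theorem, iterated halving writes [x] as a series of vectors whose partial
    sums are bounded by a geometric sequence. Adding the coordinates of these vectors gives an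
    expansion of [x] with the desired bound. *)
Lemma psum_le : exists2 K : R, 0 < K & forall n x, `|psum n x| <= K * `|x|.
Proof.
have [K K0 halving] := halving_approximation.
have [g gP] := choice halving.
exists (2 * K) => [|n x]; first by rewrite mulr_gt0.
(* [y k] is the remainder after subtracting [k] successive approximations from [x]; its norm is at
   most halved each time. *)
pose y k := iter k (fun y => y - g y) x.
have yS k : y k.+1 = y k - g (y k) by [].
pose h k : R := 2^-1 ^+ k.
have h0 k : 0 < h k by rewrite exprn_gt0// invr_gt0.
have hS k : h k.+1 = h k / 2 by rewrite /h exprSr.
have h_cvg c : c * h k @[k --> \oo] --> (0 : R).
  by apply: cvg_geometric; rewrite ger0_norm// invf_lt1// ltr1n.
have y_le k : `|y k| <= `|x| * h k.
  elim: k => [|k IHk]; first by rewrite /h expr0 mulr1.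
  have [le_half _] := gP (y k).
  by rewrite yS (le_trans le_half)// hS mulrA ler_pM2r// invr_gt0.
pose B k := K * (`|x| * h k).
have g_le i k : `|psum i (g (y k))| <= B k.
  have [_ le_K] := gP (y k); apply: le_trans (le_K i) _.
  by rewrite ler_pM2l.
(* Telescoping: [B k.+1] is half of [B k], so [B k = 2 * (B k - B k.+1)]. *)
have yD_le i m j : `|psum i (y m - y (m + j)%N)| <= 2 * (B m - B (m + j)%N).
  elim: j => [|j IHj]; first by rewrite addn0 !subrr psum0 normr0 mulr0.
  have -> : y m - y (m + j.+1)%N = (y m - y (m + j)%N) + g (y (m + j)%N).
    by rewrite addnS yS opprB addrA addrAC.
  rewrite psumD; apply: le_trans (ler_normD _ _) (le_trans (lerD IHj (g_le _ _)) _).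
  by rewrite addnS /B hS; lra.
have yB_le i m p : (m <= p)%N -> `|psum i (y m - y p)| <= 2 * B m.
  move=> /subnKC <-; apply: le_trans (yD_le _ _ _) _.
  by rewrite ler_pM2l// gerBl !mulr_ge0// ltW.
(* [x - y m] is the sum of the first [m] approximations [g (y k)]. A coordinate times [e i] is a
   difference of consecutive partial sums, so the scalar series is dominated by a geometric one. *)
have coord_y_cvg i : cvgn (fun m => coord i (x - y m)).
  have [Ii|Ii] := pselect (I i); last first.
    by under eq_fun do rewrite coord_notin//; exact: is_cvg_cst.
  have -> : (fun m => coord i (x - y m)) = series (fun k => coord i (g (y k))).
    apply/funext; elim=> [|m IHm]; first by rewrite subrr coord0// /series /= big_geq.
    by rewrite seriesSr -IHm yS opprB addrA addrAC [LHS]coordD.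
  apply: normed_cvg.
  pose c := 2 * K * `|x| / `|e i|.
  apply: (@series_le_cvg _ _ (geometric c 2^-1)) => [k|k|k|]; first exact: normr_ge0.
  - by rewrite /geometric /= !mulr_ge0 ?exprn_ge0 ?invr_ge0 ?(ltW K0).
  - have ei0 : 0 < `|e i| by rewrite normr_gt0 basis_neq0.
    have eiS : coord i (g (y k)) *: e i = psum i (g (y k)) - psum i.-1 (g (y k)).
      rewrite -[in psum i _](prednK Ii.1) partial_sumS prednK ?Ii.1//.
      by rewrite addrAC subrr add0r.
    rewrite -(ler_pM2r ei0) -normrZ eiS (le_trans (ler_normB _ _))//.
    apply: le_trans (lerD (g_le _ _) (g_le _ _)) _.
    rewrite /geometric /= /c /B -/(h k).
    suff -> : 2 * K * `|x| / `|e i| * h k * `|e i| =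
      K * (`|x| * h k) + K * (`|x| * h k) by [].
    by field; exact: lt0r_neq0.
  - by apply: is_cvg_geometric_series; rewrite ger0_norm// invf_lt1// ltr1n.
(* Continuity of the coordinates is not yet available: the limits are taken first and identified
   with the coordinates of [x] afterwards, by uniqueness. *)
pose a i := limn (fun m => coord i (x - y m)).
have psum_y_cvg i : psum i (x - y m) @[m --> \oo] --> partial_sum e a i.
  by apply: partial_sum_pointwise_cvg => j; exact: coord_y_cvg.
(* Let [p] tend to infinity in [yB_le]; the error is uniform in [i]. *)
have a_near i m : `|partial_sum e a i - psum i (x - y m)| <= 2 * B m.
  have c : `|psum i (x - y p) - psum i (x - y m)| @[p --> \oo] -->
      `|partial_sum e a i - psum i (x - y m)|.
    by apply: cvg_norm; apply: cvgB; [exact: psum_y_cvg|exact: cvg_cst].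
  apply: (ler_cvg_to c (cvg_cst _)); near=> p.
  have y_diff : (x - y p) - (x - y m) = y m - y p.
    by rewrite opprB addrC addrA subrK.
  rewrite -psumB y_diff yB_le//.
  by near: p; exact: nbhs_infty_ge.
have a_x : expansion N e x a.
  apply/expansionP; split=> [i Ii|].
    rewrite /a; under eq_fun do rewrite coord_notin//.
    exact: lim_cst.
  apply/cvgrPdist_lt => eps eps0.
  have [m m_lt] : exists m, `|x| * h m + 2 * B m < eps / 2.
    have /cvgrPdist_lt/(_ (eps / 2)) := h_cvg (`|x| * (1 + 2 * K)).
    rewrite divr_gt0// => /(_ isT)[m _ /(_ m (leqnn _))] /=.
    rewrite sub0r normrN ger0_norm => [le_eps|].
      exists m; suff -> : `|x| * h m + 2 * B m = `|x| * (1 + 2 * K) * h m by [].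
      by rewrite /B; ring.
    by rewrite !mulr_ge0 ?addr_ge0 ?mulr_ge0 ?(ltW K0) ?(ltW (h0 _)).
  have := @partial_sum_coord_cvg _ _ _ _ basis_e (x - y m).
  move=> /cvgrPdist_lt/(_ (eps / 2)); rewrite divr_gt0// => /(_ isT).
  apply: filterS => i xy_lt.
  (* The outer terms are small for every [i] by the choice of [m]; the middle one is small for large
     [i], since the expansion of [x - y m] converges. *)
  have -> : x - partial_sum e a i = y m + (x - y m - psum i (x - y m)) -
      (partial_sum e a i - psum i (x - y m)).
    by rewrite opprB [RHS]addrA -(addrA (y m)) subrK [y m + _]addrC subrK.
  apply: le_lt_trans (ler_normB _ _) _.
  have := ler_normD (y m) (x - y m - psum i (x - y m)).
  have := a_near i m; have := y_le m.
  by lra.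
(* At [m = 0] the remainder is [x] itself and [2 * B 0] is [2 * K] times its norm. *)
rewrite (coord_unique basis_e a_x); have := a_near n 0.
by rewrite subrr psum0 subr0 /B /h expr0 mulr1 mulrA.
Unshelve. all: by end_near. Qed.

Theorem basis_constant : exists K : R, forall n x,
  `|proj (initial_index N n) x| <= K * `|x|.
Proof.
have [K _ le_K] := psum_le; exists K => n x.
by rewrite -partial_sum_coord.
Qed.

End BasisConstant.

Lemma bigmaxn_mem (s : seq nat) i : i \in s -> \max_(j <- s) j \in s.
Proof.
elim: s i => // j [|k s] IHs i _; rewrite big_cons.
  by rewrite big_nil maxn0 mem_head.
rewrite /maxn inE; case: ifP => _; last by rewrite eqxx.
by rewrite (IHs _ (mem_head k s)) orbT.
Qed.

(** * Greedy sets and greedy orderings *)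

Section GreedySets.
Context {R : realType} {X : completeNormedModType R}.
Variables (N : option nat) (e : nat -> X).

Local Notation I := (index_set N).
Local Notation coord := (Defs.coord N e).
Local Notation proj := (Defs.proj N e).

(** [j] also ranges over numbers outside the index set, where the coordinates of a basis are 0 and
    the inequality is trivial. *)
Definition greedy_set (x : X) (F : {fset nat}) : Prop :=
  forall i j, i \in F -> j \notin F -> `|coord j x| <= `|coord i x|.

Lemma index_set_iota m i : I m -> i \in iota 1 m -> I i.
Proof.
move=> Im; rewrite mem_iota add1n ltnS => /andP[i0 im].
exact: (index_set_le Im i0 im).
Qed.

(** Makes the cardinality of [F] an admissible length for a greedy sum. *)
Lemma index_set_card (F : {fset nat}) :
  index_subset N F -> F != fset0 -> I #|` F|.
Proof.
move=> FI F0; split; first by rewrite cardfs_gt0.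
case: N FI => [k|//] FI; rewrite -[leqRHS](size_iota 1).
apply: uniq_leq_size => // i /FI[i0 ik].
by rewrite mem_iota i0 add1n ltnS.
Qed.

Lemma Lambda_index_subset x rho m : greedy_ordering N e x rho -> I m ->
  index_subset N (Lambda rho m).
Proof.
move=> [rhoI _ _ _] Im n /imfsetP[j /= + ->].
by move=> /(index_set_iota Im); exact: rhoI.
Qed.

Lemma card_Lambda x rho m : greedy_ordering N e x rho -> I m ->
  #|` Lambda rho m| = m.
Proof.
move=> [_ rho_inj _ _] Im; rewrite card_in_imfset/= ?size_iota//.
  by rewrite undup_id ?iota_uniq// size_iota.
move=> i j /(index_set_iota Im) Ii.
by move=> /(index_set_iota Im) Ij; exact: rho_inj.
Qed.

Hypothesis basis_e : schauder_basis N e.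

(** An index outside [Lambda rho m] with nonzero coordinate lies in the support, hence is [rho k]
    for some [k > m], and monotonicity compares it with the chosen ones. *)
Lemma greedy_set_Lambda x rho m : greedy_ordering N e x rho -> I m ->
  greedy_set x (Lambda rho m).
Proof.
move=> [rhoI rho_inj supp_rho rho_mono] Im _ j /imfsetP[/= i ri ->] jL.
have Ii : I i by exact: index_set_iota ri.
have [->|xj] := eqVneq (coord j x) 0; first by rewrite normr0.
have [k Ik kj] : (rho @` I) j.
  apply: supp_rho; split=> //.
  by apply: contra_neqP xj; exact: coord_notin.
rewrite -kj; apply: rho_mono => //.
move: ri; rewrite mem_iota add1n ltnS => /andP[_ im]; apply: leq_ltn_trans im _.
rewrite ltnNge; apply: contra jL => km; rewrite -kj.
by apply/imfsetP; exists k => //=; rewrite mem_iota Ik.1 add1n ltnS.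
Qed.

(** List [F] by decreasing modulus of the coefficients, then the rest of [1..M] likewise, where [M]
    is the maximum of [D]; beyond [M] all coordinates vanish. *)
Lemma exists_greedy_ordering x (F D : {fset nat}) :
  index_subset N D -> (F `<=` D)%fset ->
  (forall j, j \notin D -> coord j x = 0) ->
  greedy_set x F ->
  exists2 rho, greedy_ordering N e x rho & Lambda rho #|` F| = F.
Proof.
move=> DI FD x0 xF.
pose M := \max_(i <- D) i.
have DM i : i \in D -> (i <= M)%N by move=> iD; exact: leq_bigmax_seq.
have IM i : (0 < i)%N -> (i <= M)%N -> I i.
  move=> i0 iM;
  have [D0|/fset0Pn[j jD]] := eqVneq D fset0.
    by move: iM; rewrite /M D0 big_seq_fset0 leqNgt i0.
  exact: (index_set_le (DI M (bigmaxn_mem jD)) i0 iM).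
pose r i j := `|coord j x| <= `|coord i x|.
have r_total : total r by move=> i j; exact: le_total.
have r_trans : transitive r by move=> i j k ij jk; exact: le_trans jk ij.
pose rest := [seq i <- iota 1 M | i \notin F].
pose L := sort r F ++ sort r rest.
have L_perm : perm_eq L (iota 1 M).
  have sorted_perm := perm_cat (permEl (perm_sort r F)) (permEl (perm_sort r rest)).
  rewrite /L (perm_trans sorted_perm)//.
  apply: perm_trans (permEl (perm_filterC [in F] (iota 1 M))).
  rewrite perm_cat2r.
  rewrite uniq_perm ?filter_uniq ?fset_uniq ?iota_uniq// => i.
  rewrite mem_filter mem_iota add1n ltnS.
  case iF: (i \in F) => //=.
  have iD := fsubsetP FD _ iF.
  by rewrite DM// (DI _ iD).1.
have L_size : size L = M by rewrite (perm_size L_perm) size_iota.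
have L_uniq : uniq L by rewrite (perm_uniq L_perm) iota_uniq.
have L_mem i : (i \in L) = (0 < i <= M)%N.
  by rewrite (perm_mem L_perm) mem_iota add1n ltnS.
(* Sorting gives the order inside each block; across the blocks it is the greedy property of [F]. *)
have L_pair : pairwise r L.
  rewrite pairwise_cat -!sorted_pairwise// !sort_sorted// !andbT.
  apply/allrelP => i j; rewrite !mem_sort mem_filter => iF /andP[jF _].
  exact: xF.
have ltn_size j : (0 < j <= M)%N -> (j.-1 < size L)%N.
  by move=> /andP[j0 jM]; rewrite L_size prednK.
(* Lists start at 0 and orderings at 1, hence [j.-1]. The identity beyond [M] keeps [rho]
   injective. *)
pose rho j := if (0 < j <= M)%N then nth 0%N L j.-1 else j.
have rho_in j : (0 < j <= M)%N -> rho j \in L.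
  by move=> jM; rewrite /rho jM mem_nth// ltn_size.
exists rho; last first.
  apply/fsetP => i; rewrite -[RHS](mem_sort r).
  have sF : (#|` F| <= M)%N.
    by rewrite -L_size size_cat size_sort leq_addr.
  apply/imfsetP/idP => /= [[j + ->]|iF].
    rewrite mem_iota add1n ltnS => /andP[j0 jF].
    rewrite /rho j0 (leq_trans jF)//= nth_cat size_sort prednK// jF.
    by rewrite mem_nth// size_sort prednK.
  have iF_lt : (index i (sort r F) < #|` F|)%N.
    by rewrite -[X in (_ < X)%N](size_sort r) index_mem.
  exists (index i (sort r F)).+1; first by rewrite mem_iota /= add1n ltnS.
  by rewrite /rho /= (leq_trans iF_lt sF) nth_cat index_mem iF nth_index.
split.
- move=> j Ij; case: (boolP (0 < j <= M)%N) => jM.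
    by have := rho_in _ jM; rewrite L_mem => /andP[]; exact: IM.
  by rewrite /rho (negbTE jM).
- move=> j k Ij Ik; have [j0 _] := Ij; have [k0 _] := Ik.
  case: (boolP (0 < j <= M)%N) => jM; case: (boolP (0 < k <= M)%N) => kM.
  + rewrite /rho jM kM => /eqP; rewrite nth_uniq ?ltn_size//.
    by rewrite -(eqn_add2r 1) !addn1 !prednK// => /eqP.
  + move=> jk; have := rho_in _ jM; rewrite jk {1}/rho (negbTE kM) L_mem.
    by rewrite (negbTE kM).
  + move=> jk; have := rho_in _ kM; rewrite -jk {1}/rho (negbTE jM) L_mem.
    by rewrite (negbTE jM).
  + by rewrite /rho (negbTE jM) (negbTE kM).
- move=> i [Ii xi].
  have iD : i \in D by apply: contraNT xi => /x0 ->.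
  have iL : i \in L by rewrite L_mem Ii.1 DM.
  have iM : (index i L < M)%N by rewrite -L_size index_mem.
  exists (index i L).+1; first exact: IM.
  by rewrite /rho /= iM nth_index.
- move=> j k [j0 _] [k0 _] jk; rewrite {1}/rho.
  case: (boolP (0 < k <= M)%N) => kM; last first.
    rewrite (x0 k) ?normr0//; apply: contra kM => kD.
    by rewrite k0 DM.
  have jM : (0 < j <= M)%N by rewrite j0 (leq_trans (ltnW jk)); case/andP: kM.
  rewrite /rho jM; apply: (pairwiseP 0%N L_pair); rewrite ?inE ?ltn_size//.
  by rewrite -ltnS !prednK.
Qed.

(** For [n] at least the maximum of [F], the set [F] remains greedy for the truncation of [x] to its
    first [n] coordinates, which has finite support. Then let [n] tend to infinity. *)
Lemma quasi_greedy_proj : quasi_greedy N e ->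
  exists2 C : R, 0 <= C & forall F x, index_subset N F -> greedy_set x F ->
    `|proj F x| <= C * `|x|.
Proof.
(* A nonnegative constant settles empty [F], about which quasi-greediness, stated for [1 <= m], says
   nothing. *)
move=> [C0 QG]; pose C := Num.max C0 0.
have C_ge0 : 0 <= C by rewrite le_max lexx orbT.
exists C => // F x FI xF.
have [->|/fset0Pn[i0 i0F]] := eqVneq F fset0.
  by rewrite /proj /Defs.proj big_seq_fset0 normr0 mulr_ge0.
have x_cvg : `|proj (initial_index N n) x| @[n --> \oo] --> `|x|.
  by apply: cvg_norm; exact: proj_initial_cvg.
suff : \forall n \near \oo,
    `|proj F x| <= C * `|proj (initial_index N n) x|.
  move=> le_n; have : C * `|proj (initial_index N n) x| @[n --> \oo] --> C * `|x|.
    by apply: cvgM => //; exact: cvg_cst.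
  by move=> c; apply: (ler_cvg_to _ c le_n); exact: cvg_cst.
near=> n; set y := proj (initial_index N n) x.
have yE i : coord i y = if i \in initial_index N n then coord i x else 0.
  by rewrite coord_proj//; exact: initial_index_subset.
have FD : (F `<=` initial_index N n)%fset.
  apply/fsubsetP => i iF; rewrite mem_initial_index (FI i iF).1/=.
  apply/andP; split; last exact/asboolP/FI.
  apply: (@leq_trans (\max_(i <- F) i)); first exact: leq_bigmax_seq.
  near: n; exact: nbhs_infty_ge.
have -> : proj F x = proj F y.
  by apply: eq_coord_proj => i iF; rewrite yE (fsubsetP FD _ iF).
have y_greedy : greedy_set y F.
  move=> i j iF jF; rewrite !yE (fsubsetP FD _ iF).
  by case: ifP => _; [exact: xF|rewrite normr0].
have y0 j : j \notin initial_index N n -> coord j y = 0.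
  by rewrite yE => /negbTE ->.
have [rho rho_y Lambda_F] :=
  exists_greedy_ordering (@initial_index_subset N n) FD y0 y_greedy.
have IF : I #|` F| by apply: index_set_card => //; apply/fset0Pn; exists i0.
rewrite -{1}Lambda_F; apply: le_trans (QG y rho _ rho_y IF) _.
by rewrite ler_wpM2r// le_max lexx.
Unshelve. all: by end_near. Qed.

End GreedySets.

(** * Norms of finite sums with bounded or monotone coefficients *)

Section FiniteSums.
Context {R : realType} {X : normedModType R} {J : eqType}.
Implicit Types (s : seq J) (v : J -> X) (a c : J -> R).

(** The sum is a convex combination of subset sums. The offset [u] lets the induction absorb [v i],
    with weight [a i], or omit it, with weight [1 - a i]. *)
Lemma norm_convex_sum s v a (u : X) (M : R) :
  {in s, forall i, 0 <= a i <= 1} ->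
  (forall t, subseq t s -> `|u + \sum_(i <- t) v i| <= M) ->
  `|u + \sum_(i <- s) a i *: v i| <= M.
Proof.
elim: s u => [|i s IHs] u a01 uM; first by have := uM [::] isT; rewrite !big_nil.
have {}IHs w := IHs w (fun j js => a01 j (mem_behead (s := i :: s) js)).
have /andP[a0 a1] := a01 i (mem_head _ _).
rewrite big_cons; set S := \sum_(j <- s) _.
have -> : u + (a i *: v i + S) = (1 - a i) *: (u + S) + a i *: ((u + v i) + S).
  rewrite scalerBl scale1r -[RHS]addrA [X in _ = _ + X]addrC -scalerBr.
  by rewrite [u + v i + S]addrAC [_ + v i]addrC addrK addrA addrAC.
have le1 : `|u + S| <= M.
  by apply: IHs => t ts; apply: uM; exact: subseq_trans ts (subseq_cons _ _).
have le2 : `|u + v i + S| <= M.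
  apply: IHs => t ts; have := uM (i :: t); rewrite big_cons addrA; apply.
  by rewrite /= eqxx.
apply: le_trans (ler_normD _ _) _.
rewrite !normrZ (ger0_norm a0) ger0_norm ?subr_ge0//.
by nra.
Qed.

(** The positive and negative parts of [a], divided by [r], lie in [[0, 1]]; the two parts account
    for the factor 2. *)
Lemma norm_bounded_sum s v a (r M : R) : 0 <= r ->
  {in s, forall i, `|a i| <= r} ->
  (forall t, subseq t s -> `|\sum_(i <- t) v i| <= M) ->
  `|\sum_(i <- s) a i *: v i| <= 2 * (r * M).
Proof.
rewrite le_eqVlt => /predU1P[<-|r0] a_r vM.
  rewrite big1_seq ?normr0 ?mul0r ?mulr0// => i /andP[_ /a_r].
  by rewrite normr_le0 => /eqP ->; rewrite scale0r.
have part (b : J -> R) : {in s, forall i, 0 <= b i <= r} ->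
    `|\sum_(i <- s) b i *: v i| <= r * M.
  move=> b_r; rewrite -ler_pdivrMl// -[r^-1]gtr0_norm ?invr_gt0// -normrZ scaler_sumr.
  under eq_bigr do rewrite scalerA; rewrite -[X in `|X|]add0r.
  apply: norm_convex_sum => [i /b_r/andP[b0 br]|t]; last by rewrite add0r; exact: vM.
  by rewrite mulr_ge0 ?invr_ge0 ?(ltW r0)//= ler_pdivrMl ?mulr1.
have -> : \sum_(i <- s) a i *: v i =
    \sum_(i <- s) Num.max (a i) 0 *: v i - \sum_(i <- s) Num.max (- a i) 0 *: v i.
  rewrite -sumrB; apply: eq_bigr => i _; rewrite -scalerBl; congr (_ *: _).
  by have [a0|a0] := leP (a i) 0; have [b0|b0] := leP (- a i) 0; lra.
apply: le_trans (ler_normB _ _) _; rewrite mulr_natl mulr2n.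
by apply: lerD; apply: part => i /a_r; rewrite ler_norml => /andP[ra ar];
  rewrite le_max lexx orbT ge_max (ltW r0) andbT// lerNl.
Qed.

(** Abel summation by induction: subtract the smallest coefficient [c i] from all of them. The
    removed part costs [c i * M], and the rest increases within [[0, b - c i]]. *)
Lemma norm_abel_sum s v c (b M : R) :
  pairwise (fun i j => c i <= c j) s -> {in s, forall i, 0 <= c i <= b} -> 0 <= b ->
  (forall k, `|\sum_(i <- drop k s) v i| <= M) ->
  `|\sum_(i <- s) c i *: v i| <= b * M.
Proof.
elim: s c b => [|i s IHs] c b c_mono c_b b0 vM.
  by rewrite big_nil normr0 mulr_ge0// (le_trans _ (vM 0)).
move: c_mono; rewrite pairwise_cons => /andP[/allP ci c_mono].
have /andP[ci0 cib] := c_b i (mem_head _ _).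
have -> : \sum_(j <- i :: s) c j *: v j =
    c i *: \sum_(j <- i :: s) v j + \sum_(j <- s) (c j - c i) *: v j.
  rewrite !big_cons scalerDr -addrA scaler_sumr -big_split /=; congr (_ + _).
  by apply: eq_bigr => j _; rewrite -scalerDl addrC subrK.
have le1 := vM 0; rewrite drop0 in le1.
have le2 : `|\sum_(j <- s) (c j - c i) *: v j| <= (b - c i) * M.
  apply: IHs => [|j js||k]; last exact: (vM k.+1).
  - by apply: sub_pairwise c_mono => j k jk; rewrite lerD2r.
  - have /andP[_ jb] := c_b j (mem_behead (s := i :: s) js).
    by rewrite subr_ge0 ci// lerD2r.
  - by rewrite subr_ge0.
apply: le_trans (ler_normD _ _) _; rewrite normrZ (ger0_norm ci0); nra.
Qed.

End FiniteSums.

(** * Sums of basis vectors under bounded greedy projections *)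

Section GreedyEstimates.
Context {R : realType} {X : completeNormedModType R}.
Variables (N : option nat) (e : nat -> X).

Local Notation coord := (Defs.coord N e).
Local Notation proj := (Defs.proj N e).

Hypothesis basis_e : schauder_basis N e.
Variable C : R.
Hypothesis C_ge0 : 0 <= C.
Hypothesis greedy_proj_le : forall (F : {fset nat}) x,
  index_subset N F -> greedy_set N e x F ->
  `|proj F x| <= C * `|x|.

(** All coefficients of the signed sum tie on [F], so every part of [F] is a greedy set. Project
    onto the positive and the negative signs and subtract. *)
Lemma indic_sum_le_signed (F : {fset nat}) (eps : nat -> R) :
  index_subset N F -> {in F, forall i, `|eps i| = 1} ->
  `|indic_sum e F| <= 2 * C * `|\sum_(i <- F) eps i *: e i|.
Proof.
move=> FI eps1; set w := \sum_(i <- F) _.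
have wE i : coord i w = if i \in F then eps i else 0 by rewrite coord_fsum.
have part (P : pred nat) : `|proj [fset i in F | P i]%fset w| <= C * `|w|.
  apply: greedy_proj_le => [i|i j].
    by rewrite !inE => /andP[iF _]; exact: FI.
  rewrite !inE !wE => /andP[iF _] _; rewrite iF eps1//.
  by case: ifP => [/eps1 ->//|_]; rewrite normr0.
have -> : indic_sum e F = proj [fset i in F | 0 < eps i]%fset w
    - proj [fset i in F | eps i <= 0]%fset w.
  apply: (coord_inj basis_e) => i.
  have FP P : index_subset N [fset i in F | P i]%fset.
    by move=> j; rewrite !inE => /andP[jF _]; exact: FI.
  rewrite coordB// coord_indic_sum// !coord_proj// !inE wE.
  case iF: (i \in F) => /=; last by rewrite subr0.
  have := eps1 i iF; have [eps_le0|eps_gt0] := leP (eps i) 0.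
    by rewrite ler0_norm// sub0r => ->.
  by rewrite gtr0_norm// subr0 => ->.
apply: le_trans (ler_normB _ _) _.
by rewrite -mulrA mulr_natl mulr2n lerD.
Qed.

(** Order [F] by decreasing modulus of the coefficients. Multiplying these by weights that increase
    and stay at most 1 turns them into [r] times their signs, so Abel summation applies with factor
    [1 + C]; removing the signs costs [2 * C]. *)
Lemma indic_sum_le_proj (F : {fset nat}) x (r : R) : index_subset N F -> 0 <= r ->
  {in F, forall i, r <= `|coord i x|} ->
  r * `|indic_sum e F| <= 2 * C * (1 + C) * `|proj F x|.
Proof.
move=> FI; rewrite le_eqVlt => /predU1P[<- _|r0 r_le].
  by rewrite mul0r !mulr_ge0 ?addr_ge0.
set z := proj F x.
have zE i : coord i z = if i \in F then coord i x else 0 by rewrite coord_proj.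
have x_neq0 i : i \in F -> 0 < `|coord i x| by move=> /r_le; exact: lt_le_trans.
pose ge_coord i j := `|coord j x| <= `|coord i x|.
pose s := sort ge_coord F.
have sF : perm_eq s F by exact: permEl (perm_sort _ _).
have s_uniq : uniq s by rewrite sort_uniq fset_uniq.
have s_mem i : (i \in s) = (i \in F) by exact: mem_sort.
have s_pair : pairwise ge_coord s.
  rewrite -sorted_pairwise ?sort_sorted//.
    by move=> i j; exact: le_total.
  by move=> i j k ij jk; exact: le_trans jk ij.
(* The first [k] entries of [s] form a greedy set of [z], and the remaining sum is [z] minus the
   projection onto it. *)
have drop_le k : `|\sum_(i <- drop k s) coord i x *: e i| <= (1 + C) * `|z|.
  pose A := [fset i in take k s]%fset.
  have AF i : i \in A -> i \in F by rewrite !inE => /mem_take; rewrite s_mem.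
  have -> : \sum_(i <- drop k s) coord i x *: e i = z - proj A z.
    have -> : proj A z = \sum_(i <- take k s) coord i x *: e i.
      rewrite /Defs.proj (perm_big (take k s)) /=.
        by apply: eq_big_seq => i /mem_take; rewrite s_mem zE => ->.
      by rewrite uniq_perm ?fset_uniq ?take_uniq// => i; rewrite !inE.
    rewrite {1}/z /Defs.proj -(perm_big _ sF) /= -{2}(cat_take_drop k s) big_cat/=.
    by rewrite addrAC subrr add0r.
  apply: le_trans (ler_normB _ _) _; rewrite mulrDl mul1r lerD2l.
  apply: greedy_proj_le => [i /AF/FI//|i j iA jA].
  rewrite !zE (AF _ iA); case: ifP => jF; last by rewrite normr0.
  move: s_pair iA jA; rewrite -{1}(cat_take_drop k s) pairwise_cat.
  move=> /and3P[/allrelP le_s _ _].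
  rewrite !inE => iA jA; apply: (le_s i j) => //.
  by move: jF; rewrite -s_mem -{1}(cat_take_drop k s) mem_cat (negbTE jA).
have signed_le : `|\sum_(i <- F) (r * Num.sg (coord i x)) *: e i| <= (1 + C) * `|z|.
  have -> : \sum_(i <- F) (r * Num.sg (coord i x)) *: e i =
      \sum_(i <- s) (r / `|coord i x|) *: (coord i x *: e i).
    rewrite -(perm_big _ sF); apply: eq_big_seq => i; rewrite s_mem => iF.
    rewrite scalerA -mulrA [_^-1 * _]mulrC {2}[coord i x]numEsg mulfK//.
    by rewrite gt_eqF// x_neq0.
  rewrite -[leRHS]mul1r; apply: norm_abel_sum => //.
  - apply: (sub_in_pairwise (P := mem F)) s_pair => [i j iF jF ij|].
      by rewrite ler_pM2l// lef_pV2// posrE x_neq0.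
    by apply/allP => i; rewrite s_mem.
  - move=> i; rewrite s_mem => iF; rewrite divr_ge0 ?(ltW r0)//=.
    by rewrite ler_pdivrMr ?x_neq0// mul1r r_le.
have := indic_sum_le_signed FI (eps := fun i => Num.sg (coord i x)).
set w := \sum_(i <- F) _ => /(_ _)/wrap[i iF|w_le].
  by rewrite normr_sg -normr_gt0 x_neq0.
have wr : \sum_(i <- F) (r * Num.sg (coord i x)) *: e i = r *: w.
  by rewrite scaler_sumr; apply: eq_bigr => i _; rewrite scalerA.
rewrite wr normrZ gtr0_norm// in signed_le.
apply: (@le_trans _ _ (2 * C * (r * `|w|))).
  by rewrite mulrCA ler_pM2l.
by rewrite -[leRHS]mulrA ler_wpM2l// mulr_ge0.
Qed.

End GreedyEstimates.

(** * From quasi-greedy and conservative to the two residual bounds *)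

Section PartiallyGreedy.
Context {R : realType} {X : completeNormedModType R}.
Variables (N : option nat) (e : nat -> X).

Local Notation I := (index_set N).
Local Notation coord := (Defs.coord N e).
Local Notation proj := (Defs.proj N e).

Lemma alpha_le rho m i : i \in Lambda rho m -> (alpha rho m <= i)%N.
Proof.
rewrite /alpha -[i \in _]/(i \in (Lambda rho m : seq nat)).
elim: (Lambda rho m : seq nat) => // j s IHs; rewrite big_cons inE.
by case/predU1P => [->|/IHs]; [exact: geq_minl|apply: leq_trans; exact: geq_minr].
Qed.

(** The default value [rho 1] of the minimum is itself in [Lambda rho m] once [0 < m]. *)
Lemma alpha_in rho m : (0 < m)%N -> alpha rho m \in Lambda rho m.
Proof.
move=> m0; have rho1 : rho 1%N \in Lambda rho m.
  by apply/imfsetP; exists 1%N; rewrite //= mem_iota add1n ltnS.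
suff : forall s : seq nat, {subset s <= Lambda rho m} ->
    \big[minn/rho 1%N]_(i <- s) i \in Lambda rho m by apply.
elim=> [|j s IHs] sL; first by rewrite big_nil.
rewrite big_cons /minn; case: ifP => _; first by apply: sL; rewrite mem_head.
by apply: IHs => i si; apply: sL; rewrite inE si orbT.
Qed.

Lemma sigmaL_le rho m x (A : {fset nat}) : index_subset N A -> (#|` A| <= m)%N ->
  (forall a, a \in A -> (a < alpha rho m)%N) ->
  sigmaL N e rho m x <= `|x - proj A x|.
Proof.
move=> AI Am A_alpha; apply: ge_inf; last by exists A.
by exists 0 => _ [B _ <-].
Qed.

Lemma sigmaL_ge rho m x (r : R) :
  (forall A : {fset nat}, index_subset N A -> (#|` A| <= m)%N ->
    (forall a, a \in A -> (a < alpha rho m)%N) -> r <= `|x - proj A x|) ->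
  r <= sigmaL N e rho m x.
Proof.
move=> r_le; apply: lb_le_inf.
  (* The empty set is always admissible, so the infimum is over a nonempty set. *)
  by exists `|x - proj fset0 x|; exists fset0; rewrite //; split; rewrite ?cardfs0.
by move=> _ [A [AI Am A_alpha] <-]; exact: r_le.
Qed.

Lemma sigmaL_ge0 rho m x : 0 <= sigmaL N e rho m x.
Proof. exact: sigmaL_ge. Qed.

Hypothesis basis_e : schauder_basis N e.

Lemma greedy_residual_le : quasi_greedy N e -> conservative N e ->
  exists2 K : R, 0 < K & forall (A L : {fset nat}) x,
    index_subset N A -> index_subset N L -> greedy_set N e x L ->
    (#|` A| <= #|` L|)%N ->
    (forall a b, a \in (A `\` L)%fset -> b \in (L `\` A)%fset -> (a < b)%N) ->
    `|x - proj L x| <= K * `|x - proj A x|.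
Proof.
move=> /(quasi_greedy_proj basis_e)[C C0 projC] [G0 consG].
pose G := Num.max G0 0; have G_ge0 : 0 <= G by rewrite le_max lexx orbT.
(* [1 + C] pays for [y - proj F y]. For [proj D x], [2 * G] comes from convexity and conservativity,
   [2 * C * (1 + C)] from Abel summation, and the last [C] from [proj F y]. *)
exists (1 + C + 2 * G * (2 * C * (1 + C)) * C) => [|A L x AI LI xL AL A_lt].
  by rewrite -addrA ltr_pwDl// addr_ge0// !mulr_ge0// addr_ge0.
set y := x - proj A x; pose D := (A `\` L)%fset; pose F := (L `\` A)%fset.
have DI : index_subset N D by move=> i; rewrite inE => /andP[_ /AI].
have FI : index_subset N F by move=> i; rewrite inE => /andP[_ /LI].
have yE i : coord i y = if i \in A then 0 else coord i x.
  by rewrite coordB// coord_proj//; case: ifP; rewrite ?subrr ?subr0.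
have -> : x - proj L x = y - proj F y + proj D x.
  apply: (coord_inj basis_e) => i.
  rewrite coordB// coordD// coordB// !coord_proj// yE !inE.
  by case: (i \in A); case: (i \in L) => /=; rewrite ?subrr ?subr0 ?add0r ?addr0.
have yF : greedy_set N e y F.
  move=> i j; rewrite !inE !yE => /andP[/negbTE -> iL].
  by case: (j \in A) => [_|/= jL]; [rewrite normr0|exact: xL].
have projF := projC _ _ FI yF.
have D_F : (#|` D| <= #|` F|)%N.
  by rewrite !cardfsD fsetIC leq_sub2r.
pose r := \big[Num.max/0]_(i <- D) `|coord i x|.
have r_ge0 : 0 <= r by exact: bigmax_ge_id.
have r_leF : {in F, forall i, r <= `|coord i y|}.
  move=> i; rewrite inE => /andP[/negbTE iA iL]; rewrite yE iA.
  rewrite /r big_seq; apply: bigmax_le => // j; rewrite inE => /andP[jL _].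
  exact: xL.
(* Every part of [D] precedes [F] and has at most as many elements, so conservativity bounds all
   subset sums at once. *)
have projD : `|proj D x| <= 2 * (r * (G * `|indic_sum e F|)).
  apply: norm_bounded_sum => // [i iD|t tD].
    exact: (Order.TotalTheory.le_bigmax_seq 0 i xpredT (fun j => `|coord j x|) iD).
  have t_uniq : uniq t by exact: subseq_uniq tD (fset_uniq _).
  have tE : \sum_(i <- t) e i = indic_sum e [fset i in t]%fset.
    apply: perm_big; rewrite uniq_perm ?fset_uniq// => i.
    by rewrite !inE.
  have t_D i : i \in [fset i in t]%fset -> i \in D.
    by rewrite inE; exact: mem_subseq.
  apply: (@le_trans _ _ (G0 * `|indic_sum e F|)); last first.
    by rewrite ler_wpM2r// le_max lexx.
  rewrite tE; apply: consG => // [i /t_D/DI//|a b /t_D|]; first exact: A_lt.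
  by apply: leq_trans D_F; rewrite uniq_leq_size ?fset_uniq.
have := indic_sum_le_proj basis_e C0 projC FI r_ge0 r_leF.
set nF := `|indic_sum e F|; set nD := `|proj D x| => nF_le.
have := le_trans (ler_normD (y - proj F y) (proj D x)) (lerD (ler_normB _ _) (lexx _)).
move=> /le_trans; apply.
have G2 : 0 <= 2 * G by rewrite mulr_ge0.
have C2 : 0 <= 2 * C * (1 + C) by rewrite !mulr_ge0 ?addr_ge0.
have nD_le : nD <= 2 * G * (2 * C * (1 + C)) * (C * `|y|).
  apply: le_trans projD _.
  rewrite (_ : 2 * (r * (G * nF)) = 2 * G * (r * nF)); last by ring.
  by rewrite -!mulrA ler_wpM2l// ler_wpM2l// !mulrA (le_trans nF_le)// -!mulrA
    !ler_wpM2l ?addr_ge0.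
rewrite [leRHS]mulrDl; apply: lerD; last by rewrite -[leRHS]mulrA.
by rewrite mulrDl mul1r lerD2l.
Qed.

Lemma partially_greedy_of_quasi_greedy :
  quasi_greedy N e -> conservative N e -> partially_greedy N e.
Proof.
move=> QG cons; have [K K0 le_K] := greedy_residual_le QG cons.
exists K => x rho m rho_x Im; rewrite tailE//.
have A_card : (#|` initial_index N m| <= m)%N.
  rewrite -[leqRHS](size_iota 1); apply: uniq_leq_size => // i.
  by rewrite mem_initial_index mem_iota add1n ltnS => /and3P[-> ->].
apply: le_K.
- exact: initial_index_subset.
- exact: Lambda_index_subset rho_x Im.
- exact: greedy_set_Lambda.
- by rewrite (card_Lambda rho_x Im).
- move=> a b; rewrite !in_fsetD !mem_initial_index => /andP[_ /and3P[_ am _]].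
  move=> /andP[bm bL]; apply: leq_ltn_trans am _.
  have Ib := Lambda_index_subset rho_x Im bL.
  by rewrite ltnNge; apply: contra bm => bm; rewrite Ib.1 bm; apply/asboolP.
Qed.

Lemma sigmaL_bound_of_quasi_greedy : quasi_greedy N e -> conservative N e ->
  exists C : R, forall x rho m, greedy_ordering N e x rho -> I m ->
    `|x - greedy_sum N e rho m x| <= C * sigmaL N e rho m x.
Proof.
move=> QG cons; have [K K0 le_K] := greedy_residual_le QG cons.
(* Dividing by [K > 0] leaves a lower bound to prove for each admissible [A], which then passes to
   the infimum. *)
exists K => x rho m rho_x Im; rewrite -ler_pdivrMl//.
apply: sigmaL_ge => A AI Am A_alpha; rewrite ler_pdivrMl//; apply: le_K => //.
- exact: Lambda_index_subset rho_x Im.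
- exact: greedy_set_Lambda.
- by rewrite (card_Lambda rho_x Im).
- move=> a b; rewrite !in_fsetD => /andP[_ aA] /andP[_ bL].
  by apply: leq_trans (A_alpha _ aA) (alpha_le bL).
Qed.

(** * Sums of basis vectors as test vectors, and the converse implications *)

Lemma greedy_set_indic_sum (F D : {fset nat}) :
  index_subset N D -> (F `<=` D)%fset -> greedy_set N e (indic_sum e D) F.
Proof.
move=> DI /fsubsetP FD i j iF _.
by rewrite !coord_indic_sum// (FD i iF) !normr_nat ler_nat leq_b1.
Qed.

(** All coefficients on [D] tie, so an ordering may list any chosen part of [D] first. *)
Lemma indic_greedy_ordering (F D : {fset nat}) :
  index_subset N D -> (F `<=` D)%fset ->
  exists2 rho, greedy_ordering N e (indic_sum e D) rho & Lambda rho #|` F| = F.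
Proof.
move=> DI FD; apply: (exists_greedy_ordering DI) => //.
  by move=> j jD; rewrite coord_indic_sum// (negbTE jD).
exact: greedy_set_indic_sum.
Qed.

Lemma indic_sumB_proj (F D : {fset nat}) : index_subset N D -> (F `<=` D)%fset ->
  indic_sum e D - proj F (indic_sum e D) = indic_sum e (D `\` F)%fset.
Proof.
move=> DI /fsubsetP FD; apply: (coord_inj basis_e) => i.
rewrite coordB// coord_proj//; last by move=> j /FD/DI.
rewrite !coord_indic_sum//; last by move=> j; rewrite inE => /andP[_ /DI].
rewrite inE; case: ifP => /= [/FD ->|_]; first by rewrite subrr.
by rewrite subr0.
Qed.

Lemma quasi_greedy_of_sigmaL_bound (C : R) :
  (forall x rho m, greedy_ordering N e x rho -> I m ->
    `|x - greedy_sum N e rho m x| <= C * sigmaL N e rho m x) ->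
  quasi_greedy N e.
Proof.
(* The sign of [C] is unknown, hence its absolute value; the 1 comes from writing the greedy sum as
   [x] minus the residual. *)
move=> le_C; exists (1 + `|C|) => x rho m rho_x Im.
rewrite -[greedy_sum _ _ _ _ _](subKr x).
apply: le_trans (ler_normB _ _) _; rewrite mulrDl mul1r lerD2l.
apply: le_trans (le_C _ _ _ rho_x Im) _.
apply: le_trans (ler_norm _) _; rewrite normrM ler_wpM2l//.
rewrite ger0_norm ?sigmaL_ge0//.
have := @sigmaL_le rho m x fset0; rewrite /Defs.proj big_seq_fset0 subr0.
by apply=> //; rewrite cardfs0.
Qed.

Lemma conservative_of_sigmaL_bound (C : R) :
  (forall x rho m, greedy_ordering N e x rho -> I m ->
    `|x - greedy_sum N e rho m x| <= C * sigmaL N e rho m x) ->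
  conservative N e.
Proof.
move=> le_C; exists `|C| => A B AI BI AB A_B.
(* Empty [B] is treated apart, since the greedy sum is taken at length [m = |B|], which must be at
   least 1. *)
have [B0|B0] := eqVneq B fset0.
  move: A_B; rewrite B0 cardfs0 leqn0 cardfs_eq0 => /eqP ->.
  by rewrite /indic_sum big_seq_fset0 normr0 mulr0.
have IB := index_set_card BI B0.
have ABI : index_subset N (A `|` B)%fset.
  by move=> i; rewrite inE => /orP[/AI|/BI].
have AB_disj : [disjoint A & B]%fset.
  apply/fdisjointP => i iA; apply/negP => iB.
  by have := AB _ _ iA iB; rewrite ltnn.
have [rho rho_x Lambda_B] := indic_greedy_ordering ABI (fsubsetUr A B).
have := le_C _ _ _ rho_x IB; rewrite /greedy_sum Lambda_B indic_sumB_proj ?fsubsetUr//.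
rewrite fsetDUl fsetDv fsetU0 (fsetDidPl _ _ AB_disj) => /le_trans; apply.
apply: le_trans (ler_norm _) _; rewrite normrM ler_wpM2l//.
rewrite ger0_norm ?sigmaL_ge0//.
have := @sigmaL_le rho #|` B| (indic_sum e (A `|` B)%fset) A AI A_B.
rewrite indic_sumB_proj ?fsubsetUl// fsetDUl fsetDv fset0U.
rewrite fdisjoint_sym in AB_disj; rewrite (fsetDidPl _ _ AB_disj); apply => a aA.
by apply: AB => //; rewrite -[X in _ \in X]Lambda_B; apply: alpha_in; rewrite cardfs_gt0.
Qed.

Lemma quasi_greedy_of_partially_greedy (K : R) :
  (forall n x, `|proj (initial_index N n) x| <= K * `|x|) ->
  partially_greedy N e -> quasi_greedy N e.
Proof.
move=> le_K [C le_C]; exists (1 + `|C| * (1 + K)) => x rho m rho_x Im.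
rewrite -[greedy_sum _ _ _ _ _](subKr x).
apply: le_trans (ler_normB _ _) _; rewrite mulrDl mul1r lerD2l.
apply: le_trans (le_C _ _ _ rho_x Im) _.
apply: le_trans (ler_norm _) _; rewrite normrM -mulrA ler_wpM2l// normr_id.
rewrite tailE//; apply: le_trans (ler_normB _ _) _.
by rewrite mulrDl mul1r lerD2l.
Qed.

(** Greedily removing [F] from the sum over [D] leaves the sum over [A], while the tail past [|F|]
    no longer sees [E] and is a tail of the sum over [B]. *)
Lemma conservative_of_partially_greedy (K : R) :
  (forall n x, `|proj (initial_index N n) x| <= K * `|x|) ->
  partially_greedy N e -> conservative N e.
Proof.
move=> le_K [C le_C]; exists (`|C| * (1 + K)) => A B AI BI AB A_B.
have [A0|/fset0Pn[i0 i0A]] := eqVneq A fset0.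
  rewrite A0 /indic_sum big_seq_fset0 normr0.
  rewrite -mulrA mulr_ge0// mulrDl mul1r addr_ge0//.
  exact: le_trans (normr_ge0 _) (le_K 0 _).
pose m := \max_(i <- A) i.
have Am i : i \in A -> (i <= m)%N by move=> iA; exact: leq_bigmax_seq.
have mA : m \in A by exact: bigmaxn_mem i0A.
pose E := initial_index N m.
have E_mem i : (i \in E) = (0 < i <= m)%N.
  rewrite mem_initial_index andbA; case: (boolP (0 < i <= m)%N) => //= /andP[i_gt0 im].
  by apply/asboolP; exact: (index_set_le (AI _ mA) i_gt0 im).
have E_card : #|` E| = m.
  rewrite -[RHS](size_iota 1); apply: perm_size.
  rewrite uniq_perm ?fset_uniq ?iota_uniq// => i.
  by rewrite E_mem mem_iota add1n ltnS.
have AE : (A `<=` E)%fset by apply/fsubsetP => i iA; rewrite E_mem Am// (AI _ iA).1.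
pose F := ((E `\` A) `|` B)%fset; pose D := (E `|` B)%fset.
have BE i : i \in B -> i \notin E.
  by move=> iB; rewrite E_mem (leqNgt i) (AB _ _ mA iB) andbF.
have DI : index_subset N D.
  by move=> i; rewrite in_fsetU => /orP[/initial_index_subset//|/BI].
have FD : (F `<=` D)%fset.
  by rewrite fsetUSS// fsubsetDl.
have DF : (D `\` F)%fset = A.
  apply/fsetP => i; rewrite !(in_fsetD, in_fsetU); case: (boolP (i \in A)) => iA /=.
    have iE := fsubsetP AE i iA; rewrite iE orTb andbT.
    by apply: contraTN iE; exact: BE.
  by rewrite andNb.
(* [F] is a disjoint union of size [m - |A| + |B|], and [|A| <= |B|]. *)
have mF : (m <= #|` F|)%N.
  have EAB : ((E `\` A) `&` B = fset0)%fset.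
    apply/fsetP => i; rewrite in_fsetI in_fsetD in_fset0.
    case: (boolP (i \in B)) => [/BE|_].
      by move=> /negbTE ->; rewrite andbF.
    by rewrite andbF.
  rewrite cardfsU EAB cardfs0 subn0 cardfsD (fsetIidPr AE) E_card.
  by rewrite -leq_subLR subKn// -[X in (_ <= X)%N]E_card fsubset_leq_card.
have IF : I #|` F|.
  apply: index_set_card => [i iF|]; first exact/DI/(fsubsetP FD).
  by rewrite -cardfs_gt0 (leq_trans _ mF)// (AI _ mA).1.
have [rho rho_x Lambda_F] := indic_greedy_ordering DI FD.
have := le_C _ _ _ rho_x IF; rewrite /greedy_sum Lambda_F indic_sumB_proj// DF.
move=> /le_trans; apply.
apply: le_trans (ler_norm _) _; rewrite normrM -mulrA ler_wpM2l// normr_id.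
have -> : tail N e #|` F| (indic_sum e D) =
    indic_sum e B - proj (initial_index N #|` F|) (indic_sum e B).
  rewrite tailE//; apply: (coord_inj basis_e) => i.
  have II := @initial_index_subset N #|` F|.
  rewrite !coordB// !coord_proj// !coord_indic_sum//.
  case: ifP => [|iF]; first by rewrite !subrr.
  rewrite in_fsetU; case iE: (i \in E) => //; move: iE iF.
  rewrite !mem_initial_index => /and3P[-> im ->]; by rewrite (leq_trans im mF).
apply: le_trans (ler_normB _ _) _.
by rewrite mulrDl mul1r lerD2l.
Qed.

End PartiallyGreedy.

Unset Implicit Arguments.
Set Strict Implicit.
Set Printing Implicit Defensive.

Theorem theorem2p3 (R : realType) (X : completeNormedModType R)
    (N : option nat) (e : nat -> X)
    (basis_e : schauder_basis N e) (seminorm_e : seminormalized N e) :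
  (partially_greedy N e <-> (quasi_greedy N e /\ conservative N e)) /\
  ((quasi_greedy N e /\ conservative N e) <->
   exists C : R, forall (x : X) (rho : nat -> nat) (m : nat),
     greedy_ordering N e x rho -> index_set N m ->
     `|x - greedy_sum N e rho m x| <= C * sigmaL N e rho m x).
Proof.
have [K le_K] := basis_constant basis_e.
split; split.
- move=> pg; split; first exact: quasi_greedy_of_partially_greedy le_K pg.
  exact: conservative_of_partially_greedy le_K pg.
- by move=> [qg cons]; exact: partially_greedy_of_quasi_greedy.
- by move=> [qg cons]; exact: sigmaL_bound_of_quasi_greedy.
- move=> [C le_C]; split; first exact: quasi_greedy_of_sigmaL_bound le_C.
  exact: conservative_of_sigmaL_bound le_C.
Qed.
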